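(* Let $\{F(w),\chi_w,v(w)\}_{w\in\Theta}$ be a continuous $g$-fusion frame for $U$ with bounds $C,D$ (that is, $0<C\le D<\infty$ and $C\|f\|^2\le\int_\Theta v^2(w)\|\chi_w\pi_{F(w)}f\|^2\,d\mu(w)\le D\|f\|^2$ for all $f\in U$), and let $S_\chi$ be its associated continuous $g$-fusion frame operator. For $w\in\Theta$ put $T_w=\chi_w\pi_{F(w)}S_\chi^{-1}$. Then the family $\{v^2(w)\pi_{F(w)}\chi_w^*T_w\}_{w\in\Theta}$ is a continuous resolution of the identity operator on $U$. Furthermore, for all $f\in U$, $$\frac{C}{D^2}\|f\|^2\le\int_\Theta v^2(w)\|T_wf\|^2\,d\mu(w)\le\frac{D}{C^2}\|f\|^2 .$$
   Context: $U$ is a separable Hilbert space, $(\Theta,\mu)$ is a measure space with positive measure $\mu$, $\{U_w\}_{w\in\Theta}$ is a family of Hilbert spaces, and $B(\cdot,\cdot)$ denotes bounded linear operators. $\mathbb U$ is the collection of all closed subspaces of $U$, and $\pi_V$ is the orthogonal projection of $U$ onto a closed subspace $V$. $v:\Theta\to\mathbb R^+$ is measurable with $v\ne0$ a.e. $F:\Theta\to\mathbb U$ is such that $w\mapsto\pi_{F(w)}f$ is measurable for each $f\in U$, and $\chi_w\in B(F(w),U_w)$ for each $w\in\Theta$. Integrands are understood to be measurable, and vector-valued integrals are understood weakly. $\{F(w),\chi_w,v(w)\}_{w\in\Theta}$ is a continuous $g$-fusion frame for $U$ with bounds $A,B$ if $0<A\le B<\infty$ and $A\|f\|^2\le\int_\Theta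 v^2(w)\|\chi_w\pi_{F(w)}f\|^2\,d\mu(w)\le B\|f\|^2$ for all $f\in U$. Its frame operator $S_\chi:U\to U$ is defined by $\langle S_\chi f,g\rangle=\int_\Theta v^2(w)\langle\pi_{F(w)}\chi_w^*\chi_w\pi_{F(w)}f,g\rangle\,d\mu(w)$ for $f,g\in U$; it is bounded, positive and invertible. A family $\{R_w\}_{w\in\Theta}$ of bounded operators on $U$ is a continuous resolution of the identity operator on $U$ if $f=\int_\Theta R_wf\,d\mu(w)$ for every $f\in U$, i.e. $\langle f,g\rangle=\int_\Theta\langle R_wf,g\rangle\,d\mu(w)$ for all $f,g\in U$. *)

(* Defs.v *)
From HB Require Import structures.
From mathcomp Require Import all_boot all_order all_algebra.
From mathcomp Require Import all_classical all_reals all_analysis.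
From mathcomp.real_closed Require Import complex.
Set Implicit Arguments.
Unset Strict Implicit.
Unset Printing Implicit Defensive.
Import Order.TTheory GRing.Theory Num.Theory.
Import numFieldNormedType.Exports.
Local Open Scope classical_set_scope.
Local Open Scope ring_scope.

(* The scalar field of a Hilbert space is either [R] or [R[i]]; everything
   below is uniform in this choice. *)
Variant scalars := RealScalars | ComplexScalars.

Definition scalar_field (R : realType) (k : scalars) : numFieldType :=
  match k with
  | RealScalars => R : numFieldType
  | ComplexScalars => R[i] : numFieldType
  end.

Definition sconj (R : realType) (k : scalars) :
    scalar_field R k -> scalar_field R k :=
  match k with RealScalars => id | ComplexScalars => @conjc R end.

Definition sre (R : realType) (k : scalars) : scalar_field R k -> R :=
  match k with RealScalars => id | ComplexScalars => @complex.Re R end.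

Definition sim (R : realType) (k : scalars) : scalar_field R k -> R :=
  match k with RealScalars => fun=> 0 | ComplexScalars => @complex.Im R end.

Definition of_real (R : realType) (k : scalars) : R -> scalar_field R k :=
  match k with
  | RealScalars => id
  | ComplexScalars => fun r => (real_complex R r : R[i])
  end.

(* [hdot] is linear in its first argument and conjugate-linear in the second. *)
HB.mixin Record CompleteNormedModule_isHilbert (R : realType) (k : scalars) U
    & CompleteNormedModule (scalar_field R k) U := {
  hdot : {dot U for @sconj R k} ;
  hdot_norm : forall x : U, `|x| ^+ 2 = hdot x x
}.

#[short(type="hilbertType")]
HB.structure Definition Hilbert (R : realType) (k : scalars) :=
  {U of CompleteNormedModule (scalar_field R k) U
      & CompleteNormedModule_isHilbert R k U}.

(* [`|x|] lives in the scalar field, with zero imaginary part; [hnorm x] is the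
   same number in [R]. *)
Definition hnorm (R : realType) (k : scalars) (U : hilbertType R k) (x : U) : R :=
  sre `|x|.

Definition separable_space (T : topologicalType) : Prop :=
  exists2 A : set T, countable A & dense A.

Record closed_subspace (R : realType) (k : scalars) (U : hilbertType R k) :=
  ClosedSubspace {
    subspace_set :> set U ;
    subspace_submod : submod_closed (mem subspace_set) ;
    subspace_closed : closed subspace_set
  }.

Section subspace_type.
Context (R : realType) (k : scalars) (U : hilbertType R k).
Variable V : closed_subspace U.

Definition subspace_pred : {pred U} := mem (subspace_set V).

HB.instance Definition _ :=
  GRing.isSubmodClosed.Build _ U subspace_pred (subspace_submod V).

Record subspace_type := SubspaceType {
  subspace_val :> U ; _ : subspace_val \in subspace_pred
}.

HB.instance Definition _ := [isSub for subspace_val].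
HB.instance Definition _ := [Choice of subspace_type by <:].
HB.instance Definition _ := [SubChoice_isSubLmodule of subspace_type by <:].

Let snorm (x : subspace_type) : scalar_field R k := `|val x|.

Let snormD x y : snorm (x + y) <= snorm x + snorm y.
Proof. exact: ler_normD. Qed.

Let snormZ a x : snorm (a *: x) = `|a| * snorm x.
Proof. exact: normrZ. Qed.

Let snorm0_eq0 x : snorm x = 0 -> x = 0.
Proof. by move=> /normr0_eq0 x0; apply: val_inj. Qed.

HB.instance Definition _ :=
  Lmodule_isNormed.Build _ subspace_type snormD snormZ snorm0_eq0.

Let subspace_complete (F : set_system subspace_type) :
  ProperFilter F -> cauchy F -> cvg F.
Proof.
move=> FF /cauchyP Fc.
pose G : set_system U := subspace_val @ F.
have GF : ProperFilter G by exact: fmap_proper_filter.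
have /cauchy_cvg/cvg_ex[l Gl] : cauchy G.
  apply/cauchyP => e e0; have [x xF] := Fc e e0.
  exists (subspace_val x); rewrite /G /fmap /=.
  by apply: filterS xF => y; rewrite -!ball_normE.
have Vl : subspace_set V l.
  apply: subspace_closed => B /Gl GB.
  have {}GB : F (subspace_val @^-1` B) by [].
  have [x Bx] := filter_ex GB.
  by exists (subspace_val x); split=> //; exact/set_mem/(valP x).
apply/cvg_ex; exists (SubspaceType (mem_set Vl)).
apply/cvg_ballP => e e0.
have le : F (subspace_val @^-1` ball l e) := Gl _ (nbhsx_ballx l e e0).
by apply: filterS le => x /=; rewrite -!ball_normE.
Qed.

HB.instance Definition _ :=
  Uniform_isComplete.Build subspace_type subspace_complete.

Let sdot (x y : subspace_type) : scalar_field R k := hdot (val x) (val y).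

Let sdot_additivel y : zmod_morphism (sdot ^~ y).
Proof. by move=> a b; rewrite /sdot /= linearBl. Qed.

Let sdot_additiver x : zmod_morphism (sdot x).
Proof. by move=> a b; rewrite /sdot /= linearBr. Qed.

Let sdot_scalablel y : scalable_for *%R (sdot ^~ y).
Proof. by move=> a b; rewrite /sdot /= linearZl_LR. Qed.

Let sdot_scalabler x : scalable_for (@sconj R k \; *%R) (sdot x).
Proof. by move=> a b; rewrite /sdot /= linearZr_LR. Qed.

HB.instance Definition _ := isBilinear.Build _ _ _ _ _ _ sdot
  sdot_additivel sdot_additiver sdot_scalablel sdot_scalabler.

Let sdot_hermitian x y : sdot x y = (-1) ^+ false * sconj (sdot y x).
Proof. exact: hermitian_subproof. Qed.

HB.instance Definition _ :=
  isHermitianSesquilinear.Build _ _ false (@sconj R k) sdot sdot_hermitian.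

Let sdot_gt0 x : x != 0 -> 0 < sdot x x.
Proof. by move=> x0; apply: neq0_dnorm_gt0; apply: contra x0 => /eqP xE; apply/eqP/val_inj. Qed.

HB.instance Definition _ := isDotProduct.Build _ _ sdot sdot_gt0.

Let sdot_norm (x : subspace_type) : `|x| ^+ 2 = sdot x x.
Proof. exact: hdot_norm. Qed.

HB.instance Definition _ :=
  CompleteNormedModule_isHilbert.Build R k subspace_type sdot_norm.

End subspace_type.

Section operators.
Context (R : realType) (k : scalars).

Definition bounded_operator (H1 H2 : hilbertType R k) (A : H1 -> H2) : Prop :=
  linear A /\ exists M : R, forall x : H1, hnorm (A x) <= M * hnorm x.

(* [xget 0 P] is an element of [P] if there is one, and [0] otherwise; in the
   three uses below [P] has at most one element. *)
Definition adjoint (H1 H2 : hilbertType R k) (A : H1 -> H2) (y : H2) : H1 :=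
  xget 0 [set z : H1 | forall x : H1, hdot (A x) y = hdot x z].

(* The projection takes its values in [V] itself, so that it can be composed
   with operators defined on [V] only; the coercion [subspace_val] turns its
   values back into elements of [U]. *)
Definition orth_proj (U : hilbertType R k) (V : closed_subspace U) (f : U) :
    subspace_type V :=
  xget 0 [set p : subspace_type V |
            forall y : subspace_type V,
              hdot (f - subspace_val p) (subspace_val y) = 0].

End operators.

(* On a separable Hilbert space this agrees with weak measurability, i.e.
   measurability of all [fun w => hdot (h w) g]. *)
Definition borel_measurable d (T : measurableType d) (X : topologicalType)
    (h : T -> X) : Prop :=
  forall O : set X, open O -> measurable (h @^-1` O).

Section scalar_integral.
Context d (T : measurableType d) (R : realType) (k : scalars).
Variable mu : {measure set T -> \bar R}.

(* [h] is integrable (in particular measurable) with integral [z]. *)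
Definition has_scalar_integral (h : T -> scalar_field R k)
    (z : scalar_field R k) : Prop :=
  [/\ mu.-integrable [set: T] (fun w => (sre (h w))%:E),
      mu.-integrable [set: T] (fun w => (sim (h w))%:E),
      sre z = \int[mu]_w sre (h w) &
      sim z = \int[mu]_w sim (h w)].

Definition weak_integral (U : hilbertType R k) (h : T -> U) (u : U) : Prop :=
  forall g : U, has_scalar_integral (fun w => hdot (h w) g) (hdot u g).

Definition resolution_of_identity (U : hilbertType R k) (A : T -> U -> U) :
    Prop :=
  (forall w, bounded_operator (A w)) /\
  forall f : U, weak_integral (fun w => A w f) f.

End scalar_integral.

Section g_fusion_frame.
Context d (T : measurableType d) (R : realType) (k : scalars).
Variables (mu : {measure set T -> \bar R}) (U : hilbertType R k).
Variables (W : T -> hilbertType R k) (F : T -> closed_subspace U).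
Variable chi : forall w, subspace_type (F w) -> W w.
Variable v : T -> R.
Local Arguments chi w _ : clear implicits.

Definition g_fusion_data : Prop :=
  [/\ forall f : U, borel_measurable (fun w => subspace_val (orth_proj (F w) f)),
      forall w, bounded_operator (chi w),
      measurable_fun [set: T] v,
      forall w, 0 <= v w &
      {ae mu, forall w, v w != 0}].

Definition continuous_g_fusion_frame (A B : R) : Prop :=
  [/\ g_fusion_data, 0 < A, A <= B &
   forall f : U,
     let q w := v w ^+ 2 * hnorm (chi w (orth_proj (F w) f)) ^+ 2 in
     [/\ measurable_fun [set: T] q,
         ((A * hnorm f ^+ 2)%:E <= \int[mu]_w (q w)%:E)%E &
         (\int[mu]_w (q w)%:E <= (B * hnorm f ^+ 2)%:E)%E]].

Definition frame_operator (f : U) : U :=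
  xget 0 [set y : U | forall g : U, has_scalar_integral mu
    (fun w => of_real k (v w ^+ 2) *
       hdot (subspace_val (orth_proj (F w)
               (adjoint (chi w) (chi w (orth_proj (F w) f))))) g)
    (hdot y g)].

End g_fusion_frame.

(* Main.v *)
From HB Require Import structures.
From mathcomp Require Import all_boot all_order all_algebra.
From mathcomp Require Import all_classical all_reals all_analysis.
From mathcomp.real_closed Require Import complex.
From mathcomp Require Import ring lra.
Require Import Defs.
Set Implicit Arguments.
Unset Strict Implicit.
Unset Printing Implicit Defensive.
Import Order.TTheory GRing.Theory Num.Theory.
Import numFieldNormedType.Exports.
Local Open Scope classical_set_scope.
Local Open Scope ring_scope.

(** The form [a(f, g) = \int v^2 <chi_w pi_w f, chi_w pi_w g>] is a Hermitian
    form whose quadratic part lies between [C |f|^2] and [D |f|^2], and it is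
    represented by the frame operator: [<S f, g> = a(f, g)].  Hence
    [C |f| <= |S f|], from [a(f, f) <= |S f| |f|], and [|S f| <= D |f|], from
    the Cauchy-Schwarz inequality for [a].  The operator [S] is injective by
    the lower bound and surjective because [a] is a scalar product equivalent
    to that of [U], so that every functional [<h, .>] is some [a(p, .)].
    Therefore [S^-1] is a linear map with [|h| / D <= |S^-1 h| <= |h| / C].
    The identity [<h, g> = <S (S^-1 h), g>] is the resolution of the identity,
    and the frame inequalities at [S^-1 h] give the two bounds
    [C / D^2 |h|^2] and [D / C^2 |h|^2].

    A single representation theorem, [riesz_form], supplies the orthogonal
    projections, the adjoints, the existence of [S f] and the surjectivity of
    [S].  It concerns bounded coercive symmetric forms and is proved by
    minimizing [a(x, x) - 2 L x] along a minimizing sequence, which the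
    parallelogram identity makes Cauchy.

    Scalars, real or complex, are handled through real parts: the real part of
    a form linear in one argument determines the form, since its value at
    [conj(z) x] is [|z|^2] when its value at [x] is [z]; and the imaginary part
    of [z] is the real part of [- i z].  The integrands are measurable by
    polarization of the energies [v^2 |chi_w pi_w f|^2]. *)

(** * Real parts of scalars *)

Section scalars.
Context (R : realType) (k : scalars).
Implicit Types (z : scalar_field R k) (r : R).

Lemma sreD z1 z2 : sre (z1 + z2) = sre z1 + sre z2.
Proof. by case: k z1 z2 => //= -[? ?] [? ?]. Qed.

Lemma sre_mul_real r z : sre (of_real k r * z) = r * sre z.
Proof. by case: k z => //= -[a b] /=; rewrite mul0r subr0. Qed.

Lemma sim_mul_real r z : sim (of_real k r * z) = r * sim z.
Proof. by case: k z => //= [_|[a b] /=]; rewrite ?mulr0 ?mul0r ?addr0. Qed.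

Lemma sre_conj z : sre (sconj z) = sre z.
Proof. by case: k z => //= -[a b]. Qed.

Lemma sconjK z : sconj (sconj z) = z.
Proof. by case: k z => //= -[a b] /=; rewrite opprK. Qed.

Lemma sre_of_real r : sre (of_real k r) = r.
Proof. by case: k. Qed.

Lemma of_real_sqr r : of_real k r ^+ 2 = of_real k (r ^+ 2).
Proof. by case: k => //=; rewrite rmorphXn. Qed.

Lemma of_realN1 : of_real k (-1 : R) = -1.
Proof. by case: k => //=; rewrite rmorphN1. Qed.

Lemma of_real_norm (x : scalar_field R k) : 0 <= x -> x = of_real k (sre x).
Proof.
by case: k x => //= x x0; apply/esym/RRe_real/ger0_real.
Qed.

Lemma of_real_le r s : (of_real k r <= of_real k s) = (r <= s).
Proof. by case: k => //=; rewrite lecR. Qed.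

Lemma of_real_lt r s : (of_real k r < of_real k s) = (r < s).
Proof. by case: k => //=; rewrite ltcR. Qed.

Lemma sre_conj_mul_eq0 z : sre (sconj z * z) = 0 -> z = 0.
Proof.
case: k z => /= [z /eqP|[a b] /= /eqP].
  by rewrite mulf_eq0 orbb => /eqP.
rewrite mulNr opprK -!expr2 paddr_eq0 ?sqr_ge0// !sqrf_eq0.
by move=> /andP[/eqP -> /eqP ->].
Qed.

(** [- i] in the complex case.  In the real case it is [0], so that [sim_sre]
    holds for both kinds of scalars. *)
Definition minus_i : scalar_field R k :=
  match k with RealScalars => 0 | ComplexScalars => (- 'i%C : R[i]) end.

Lemma sim_sre z : sim z = sre (minus_i * z).
Proof.
rewrite /minus_i; case: k z => /= [z|[a b]/=]; first by rewrite mul0r.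
by rewrite oppr0 mul0r sub0r mulN1r opprK.
Qed.

End scalars.

(** * Real symmetric forms and completeness *)

(** A quadratic polynomial without constant term that is nonnegative
    everywhere has no linear term. *)
Lemma nonneg_quadratic (R : realFieldType) (b c : R) :
  (forall t, 0 <= 2 * t * b + t ^+ 2 * c) -> b = 0.
Proof.
move=> h.
have c0 : 0 <= c by have := h 1; have := h (-1); lra.
(* The minimizer is [- b / c]; the denominator [c + 1] also covers [c = 0]. *)
have hb := h (- b / (c + 1)).
have c1 : c + 1 != 0 by rewrite lt0r_neq0// ltr_wpDl.
have E : 2 * (- b / (c + 1)) * b + (- b / (c + 1)) ^+ 2 * c
  = - (b ^+ 2 * ((c + 2) / (c + 1) ^+ 2)) by field.
move: hb; rewrite E oppr_ge0 pmulr_lle0.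
  by move=> b0; apply/eqP; rewrite -sqrf_eq0 eq_le b0 sqr_ge0.
by rewrite divr_gt0// ?exprn_gt0//; lra.
Qed.

Section hilbert.
Context (R : realType) (k : scalars) (U : hilbertType R k).
Implicit Types (x y z : U) (r t : R).

(** The real scalar product underlying the Hilbert space structure. *)
Definition rdot x y : R := sre (hdot x y).

Lemma hnormE x : `|x| = of_real k (hnorm x).
Proof. exact/of_real_norm/normr_ge0. Qed.

Lemma hnorm_ge0 x : 0 <= hnorm x.
Proof.
have := normr_ge0 x; rewrite hnormE -(_ : of_real k (0 : R) = 0) ?of_real_le//.
by case: k.
Qed.

Lemma rdotxx x : rdot x x = hnorm x ^+ 2.
Proof. by rewrite /rdot -hdot_norm hnormE of_real_sqr sre_of_real. Qed.

Lemma hdotC x y : hdot x y = sconj (hdot y x).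
Proof. by rewrite [LHS]hermitian_subproof expr0 mul1r. Qed.

Lemma rdotC x y : rdot x y = rdot y x.
Proof. by rewrite /rdot hdotC sre_conj. Qed.

(** Linearity over the reals, for a functional on a space whose scalars may be
    complex. *)
Definition real_linear (L : U -> R) : Prop :=
  (forall x y, L (x + y) = L x + L y) /\
  (forall t x, L (of_real k t *: x) = t * L x).

(** Real-valued symmetric forms that are bilinear over the reals. *)
Definition symmetric_form (a : U -> U -> R) : Prop :=
  (forall x y, a x y = a y x) /\ (forall y, real_linear (a ^~ y)).

Lemma rdot_form : symmetric_form rdot.
Proof.
split=> [x y|y]; first exact: rdotC.
split=> [x z|t x]; rewrite /rdot; first by rewrite linearDl sreD.
by rewrite linearZl_LR sre_mul_real.
Qed.

Section form.
Variable a : U -> U -> R.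
Hypothesis fa : symmetric_form a.

Lemma formC x y : a x y = a y x. Proof. exact: fa.1. Qed.
Lemma formDl x y z : a (x + y) z = a x z + a y z. Proof. exact: (fa.2 z).1. Qed.
Lemma formDr x y z : a z (x + y) = a z x + a z y.
Proof. by rewrite !(formC z) formDl. Qed.
Lemma formZl t x z : a (of_real k t *: x) z = t * a x z.
Proof. exact: (fa.2 z).2. Qed.
Lemma formZr t x z : a z (of_real k t *: x) = t * a z x.
Proof. by rewrite !(formC z) formZl. Qed.
Lemma formNl x z : a (- x) z = - a x z.
Proof. by rewrite -scaleN1r -of_realN1 formZl mulN1r. Qed.
Lemma formNr x z : a z (- x) = - a z x.
Proof. by rewrite !(formC z) formNl. Qed.
Definition formE := (formDl, formDr, formNl, formNr, formZl, formZr).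

Lemma form_quadratic t x y :
  a (x + of_real k t *: y) (x + of_real k t *: y) =
  a x x + 2 * t * a x y + t ^+ 2 * a y y.
Proof. by rewrite !formE (formC y x); ring. Qed.

Lemma form_CauchySchwarz x y : (forall x, 0 <= a x x) ->
  a x y ^+ 2 <= a x x * a y y.
Proof.
move=> a0; have [ay|ay] := eqVneq (a y y) 0.
  have -> : a x y = 0.
    apply/eqP; apply/negPn/negP => axy.
    (* With [a y y = 0] the form is affine on this line; this point gives -1. *)
    have := a0 (x + of_real k (- (a x x + 1) / (2 * a x y)) *: y).
    rewrite form_quadratic ay mulr0 addr0.
    have -> : a x x + 2 * (- (a x x + 1) / (2 * a x y)) * a x y = -1 by field.
    by rewrite ler0N1.
  by rewrite expr0n /= ay mulr0.
have ay0 : 0 < a y y by rewrite lt0r ay a0.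
have := a0 (x + of_real k (- a x y / a y y) *: y).
rewrite form_quadratic.
have -> : a x x + 2 * (- a x y / a y y) * a x y + (- a x y / a y y) ^+ 2 * a y y
  = (a x x * a y y - a x y ^+ 2) / a y y by field.
by rewrite pmulr_lge0 ?invr_gt0// subr_ge0.
Qed.

Lemma form_bound (M : R) x y : 0 <= M -> (forall x, 0 <= a x x) ->
  (forall x, a x x <= M * hnorm x ^+ 2) -> `|a x y| <= M * hnorm x * hnorm y.
Proof.
move=> M0 a0 aM.
rewrite -ler_sqr ?nnegrE ?mulr_ge0 ?hnorm_ge0//.
rewrite real_normK ?num_real//.
apply: (le_trans (form_CauchySchwarz x y a0)).
have -> : (M * hnorm x * hnorm y) ^+ 2 = (M * hnorm x ^+ 2) * (M * hnorm y ^+ 2) by ring.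
exact: ler_pM.
Qed.

End form.

Lemma hnorm0 : hnorm (0 : U) = 0.
Proof. by apply/eqP; rewrite -sqrf_eq0 -rdotxx /rdot linear0l; case: k. Qed.

Lemma hnorm_real_scale t x : 0 <= t -> hnorm (of_real k t *: x) = t * hnorm x.
Proof.
move=> t0; apply/eqP; rewrite -(@eqrXn2 _ 2) ?mulr_ge0 ?hnorm_ge0//.
by rewrite -rdotxx !(formE rdot_form) rdotxx exprMn mulrA -expr2.
Qed.

Lemma hnorm_eq0 x : hnorm x = 0 -> x = 0.
Proof.
move=> x0; apply/normr0_eq0; rewrite hnormE x0.
by case: k.
Qed.

Lemma rdot_bound x y : `|rdot x y| <= hnorm x * hnorm y.
Proof.
have := @form_bound _ rdot_form 1 x y; rewrite mul1r; apply => // z.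
  by rewrite rdotxx sqr_ge0.
by rewrite rdotxx mul1r.
Qed.

(** Completeness for sequences, with distances measured by the real-valued
    norm. *)
Lemma hilbert_complete (u : nat -> U) :
  (forall e, 0 < e -> exists N, forall m n, (N <= m)%N -> (N <= n)%N ->
     hnorm (u m - u n) < e) ->
  exists p, forall e, 0 < e -> exists N, forall n, (N <= n)%N ->
     hnorm (u n - p) < e.
Proof.
move=> uC.
have real_gt0 (e : scalar_field R k) : 0 < e -> 0 < sre e /\ e = of_real k (sre e).
  move=> e0; have eE := of_real_norm (ltW e0); split => //.
  by rewrite -(of_real_lt k) -eE; move: e0; clear; case: k e.
have /cauchy_cvg/cvg_ex[p up] : cauchy (u @ \oo).
  apply/cauchyP => e /real_gt0[e0 ->].
  have [N uN] := uC _ e0; exists (u N).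
  exists N => // n /= Nn; rewrite -ball_normE /=.
  by rewrite hnormE of_real_lt; exact: uN.
exists p => e e0.
move/cvgrPdist_lt: up => /(_ (of_real k e)).
have -> : 0 < of_real k e.
  by rewrite -(_ : of_real k (0 : R) = 0) ?of_real_lt//; clear; case: k.
move=> /(_ isT)[N _ h]; exists N => n Nn.
by have := h n Nn; rewrite /= -normrN opprB hnormE of_real_lt.
Qed.

End hilbert.

(** * The representation theorem *)

Section riesz.
Context (R : realType) (k : scalars) (U : hilbertType R k).
Implicit Types (x y z : U) (r t : R).

(** The Riesz representation theorem for a bounded coercive symmetric form; only
    the structure over the reals is involved. *)
Theorem riesz_form (a : U -> U -> R) (L : U -> R) (c M K : R) :
  symmetric_form a -> real_linear L -> 0 < c -> 0 <= M ->
  (forall x, c * hnorm x ^+ 2 <= a x x) ->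
  (forall x, a x x <= M * hnorm x ^+ 2) ->
  (forall x, L x <= K * hnorm x) ->
  exists p, forall y, L y = a p y.
Proof.
move=> fa [LD LZ] c0 M0 ac aM LK.
have a0 x : 0 <= a x x by apply: le_trans (ac x); rewrite mulr_ge0 ?sqr_ge0 ?ltW.
pose J x := a x x - 2 * L x.
(* Completing the square. *)
have Jlb x : - (K ^+ 2 / c) <= J x.
  rewrite /J lerBrDr; apply: le_trans (ac x).
  have := LK x; set n := hnorm x => Ln.
  rewrite -subr_ge0.
  apply: (@le_trans _ _ (c * (n - K / c) ^+ 2)).
    by rewrite mulr_ge0 ?sqr_ge0 ?ltW.
  have -> : c * (n - K / c) ^+ 2 = c * n ^+ 2 - (- (K ^+ 2 / c) + 2 * (K * n)).
    by field; rewrite gt_eqF.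
  by lra.
pose m := inf (range J).
have hi : has_inf (range J).
  split; first by exists (J 0), 0.
  by exists (- (K ^+ 2 / c)) => _ [x _ <-].
have Jm x : m <= J x by apply: ge_inf; [exact: hi.2 | exists x].
have /choice[u uJ] : forall n : nat, exists x, J x < m + n.+1%:R^-1.
  move=> n.
  have n0 : 0 < n.+1%:R^-1 :> R by rewrite invr_gt0.
  have [_ [x _ <-] Jx] := inf_adherent n0 hi.
  by exists x.
(* The parallelogram identity, with [m <= J ((x + y) / 2)]. *)
have par x y : c * hnorm (x - y) ^+ 2 <= 2 * (J x - m) + 2 * (J y - m).
  apply: le_trans (ac _) _.
  have := Jm (of_real k 2^-1 *: (x + y)).
  rewrite /J !(formE fa) LZ LD (formC fa y x) => h; lra.
have small (e : R) : 0 < e -> exists N, forall n, (N <= n)%N -> (n.+1%:R^-1 : R) < e.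
  move=> e0; exists (Num.truncn e^-1) => n Nn.
  rewrite invf_plt ?posrE// (lt_le_trans (truncnS_gt _))//.
  by rewrite ler_nat.
have [p up] : exists p, forall e : R, 0 < e -> exists N, forall n, (N <= n)%N ->
    hnorm (u n - p) < e.
  apply: hilbert_complete => e e0.
  have [|N HN] := small (c * e ^+ 2 / 4).
    by rewrite divr_gt0// mulr_gt0// exprn_gt0.
  exists N => i j Ni Nj.
  rewrite -ltr_sqr ?nnegrE ?hnorm_ge0 ?(ltW e0)// -(ltr_pM2l c0).
  apply: le_lt_trans (par _ _) _.
  have := uJ i; have := uJ j; have := HN i Ni; have := HN j Nj.
  set ri := i.+1%:R^-1; set rj := j.+1%:R^-1; lra.
(* The first variation of [J] at [p] vanishes; [J (p + t y)] is bounded below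
   through [J (u n + t y)], with no continuity of [J] needed. *)
exists p => y; apply/eqP; rewrite -subr_eq0 -oppr_eq0 opprB; apply/eqP.
apply: (@nonneg_quadratic _ _ (a y y)) => t.
suff h (e : R) : 0 < e -> 0 <= 2 * t * (a p y - L y) + t ^+ 2 * a y y + e.
  by apply/ler_addgt0Pr => e; exact: h.
move=> e0; rewrite addrC -lerBlDr sub0r.
(* [q] is a Lipschitz constant of [x |-> 2 t a(x, y)], made positive by the
   added [1]. *)
pose q : R := 2 * `|t| * M * hnorm y + 1.
have q0 : 0 < q.
  by rewrite ltr_wpDl// !mulr_ge0 ?hnorm_ge0.
have [N1 HN1] := small (e / 2) (divr_gt0 e0 (ltr0Sn _ _)).
have [N2 HN2] := up (e / (2 * q)) (divr_gt0 e0 (mulr_gt0 (ltr0Sn _ _) q0)).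
have {HN1} := HN1 _ (leq_maxl N1 N2).
have {HN2} := HN2 _ (leq_maxr N1 N2).
set n := maxn N1 N2 => un n1.
have := uJ n; have := Jm (u n + of_real k t *: y).
rewrite /J (form_quadratic fa) LD LZ.
set r := n.+1%:R^-1 in n1 * => h1 h2.
have key : - r <= 2 * t * (a (u n) y - L y) + t ^+ 2 * a y y by lra.
have := form_bound fa (u n - p) y M0 a0 aM.
rewrite (formDl fa) (formNl fa) => hb.
have hb2 : 2 * t * (a (u n) y - a p y) <= e / 2.
  apply: le_trans (ler_norm _) _; rewrite !normrM normr_nat.
  apply: (@le_trans _ _ (q * hnorm (u n - p))).
    rewrite /q; have := hnorm_ge0 (u n - p).
    set s := hnorm (u n - p) in hb *; set w := `|t| => s0.
    have w0 : 0 <= w := normr_ge0 t.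
    apply: (@le_trans _ _ (2 * w * (M * s * hnorm y))); last by lra.
    by apply: ler_wpM2l => //; rewrite mulr_ge0.
  rewrite mulrC -ler_pdivlMr//; move: un => /ltW; congr (_ <= _).
  by field; rewrite gt_eqF.
lra.
Qed.

End riesz.

(** * Orthogonal projections and adjoints *)

Section subspaces_and_adjoints.
Context (R : realType) (k : scalars).
Implicit Types (U H : hilbertType R k).

(** The real scalar product is nondegenerate. *)
Lemma rdot_inj U (x y : U) : (forall z, rdot x z = rdot y z) -> x = y.
Proof.
move=> h; apply/eqP; rewrite -subr_eq0; apply/eqP/hnorm_eq0.
apply/eqP; rewrite -sqrf_eq0 -rdotxx (formDl (rdot_form U)).
by rewrite (formNl (rdot_form U)) h subrr.
Qed.

(** A functional that is homogeneous over the scalars vanishes as soon as its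
    real part does, since its value at [conj (L x) x] is [|L x|^2]. *)
Lemma homogeneous_eq0 U (L : U -> scalar_field R k) :
  (forall c x, L (c *: x) = c * L x) -> (forall x, sre (L x) = 0) ->
  forall x, L x = 0.
Proof. by move=> LZ L0 x; apply: sre_conj_mul_eq0; rewrite -LZ. Qed.

Lemma linear_add (V W : lmodType (scalar_field R k)) (A : V -> W) :
  linear A -> forall x y, A (x + y) = A x + A y.
Proof. by move=> lA x y; have := lA 1 x y; rewrite !scale1r. Qed.

Lemma linear_scale (V W : lmodType (scalar_field R k)) (A : V -> W) :
  linear A -> forall c x, A (c *: x) = c *: A x.
Proof.
move=> lA c x; have A0 : A 0 = 0.
  by apply: (addrI (A 0)); rewrite -(linear_add lA) !addr0.
by have := lA c x 0; rewrite A0 !addr0.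
Qed.

Lemma riesz H (L : H -> R) (K : R) : real_linear L ->
  (forall x, L x <= K * hnorm x) -> exists p, forall y, L y = rdot p y.
Proof.
move=> rL LK; apply: (@riesz_form _ _ _ (@rdot _ _ H) L 1 1 K) => //.
- exact: rdot_form.
- by move=> x; rewrite mul1r rdotxx.
- by move=> x; rewrite mul1r rdotxx.
Qed.

Lemma hdotDl U (x y z : U) : hdot (x + y) z = hdot x z + hdot y z.
Proof. by rewrite linearDl. Qed.
Lemma hdotBl U (x y z : U) : hdot (x - y) z = hdot x z - hdot y z.
Proof. by rewrite linearBl. Qed.
Lemma hdotZl U c (x z : U) : hdot (c *: x) z = c * hdot x z.
Proof. by rewrite linearZl_LR. Qed.
Lemma hdotZr U c (x z : U) : hdot x (c *: z) = sconj c * hdot x z.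
Proof. by rewrite linearZr_LR. Qed.

Lemma hdot_eq0C U (x y : U) : hdot x y = 0 -> hdot y x = 0.
Proof. by move=> h; rewrite hdotC h; case: (k) => //=; rewrite oppr0. Qed.

Section projection.
Context (U : hilbertType R k) (V : closed_subspace U).
Implicit Types (f g : U) (x y p : subspace_type V).

(** The projection theorem: the projection of [f] represents the functional
    [<., f>] restricted to the Hilbert space [V]. *)
Lemma orth_projP f y : hdot (f - subspace_val (orth_proj V f)) (subspace_val y) = 0.
Proof.
rewrite /orth_proj; case: xgetP => [p -> //|] no; exfalso.
have [||p pP] := @riesz (subspace_type V) (fun y => rdot (subspace_val y) f) (hnorm f).
- split=> [x z|t x]; first by rewrite -(formDl (rdot_form U)).
  by rewrite -(formZl (rdot_form U)).
- move=> x; rewrite mulrC; apply: le_trans (ler_norm _) _; exact: rdot_bound.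
apply: (no p) => z; apply: hdot_eq0C.
apply: (@homogeneous_eq0 (subspace_type V) (fun z => hdot (subspace_val z) (f - subspace_val p))).
  by move=> c x; rewrite -hdotZl.
move=> x; have := pP x.
rewrite -/(rdot _ _) (formDr (rdot_form U)) (formNr (rdot_form U)) => ->.
by rewrite rdotC; apply/eqP; rewrite subr_eq0.
Qed.

Lemma orth_proj_uniq f p :
  (forall y, hdot (f - subspace_val p) (subspace_val y) = 0) -> orth_proj V f = p.
Proof.
move=> pP; apply: rdot_inj => z; rewrite /rdot.
have : hdot (subspace_val (orth_proj V f)) (subspace_val z) =
       hdot (subspace_val p) (subspace_val z).
  apply/esym/eqP; rewrite -subr_eq0 -hdotBl.
  have -> : subspace_val p - subspace_val (orth_proj V f) =
    (f - subspace_val (orth_proj V f)) - (f - subspace_val p).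
    by rewrite opprB [RHS]addrC addrA subrK.
  by rewrite hdotBl orth_projP pP subrr.
by rewrite /hdot/= => ->.
Qed.

Lemma orth_projK p : orth_proj V (subspace_val p) = p.
Proof. by apply: orth_proj_uniq => y; rewrite subrr linear0l. Qed.

Lemma orth_proj_linear : linear (orth_proj V : U -> subspace_type V).
Proof.
move=> c f g; apply: orth_proj_uniq => y.
have -> : c *: f + g - subspace_val (c *: orth_proj V f + orth_proj V g) =
  c *: (f - subspace_val (orth_proj V f)) + (g - subspace_val (orth_proj V g)).
  rewrite [subspace_val (_ + _)](_ : _ = c *: subspace_val (orth_proj V f) +
    subspace_val (orth_proj V g))//.
  by rewrite scalerBr opprD addrACA.
by rewrite hdotDl hdotZl !orth_projP mulr0 addr0.
Qed.

Lemma hdot_proj_r p g : hdot (subspace_val p) g = hdot p (orth_proj V g).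
Proof.
apply/eqP; rewrite [X in _ == X](_ : _ = hdot (subspace_val p) (subspace_val (orth_proj V g)))//.
by rewrite -subr_eq0 -linearBr /= hdot_eq0C// orth_projP.
Qed.

Lemma orth_proj_bound f : hnorm (orth_proj V f) <= hnorm f.
Proof.
have [n0|n0] := eqVneq (hnorm (orth_proj V f)) 0; first by rewrite n0 hnorm_ge0.
have np : 0 < hnorm (orth_proj V f) by rewrite lt0r n0 hnorm_ge0.
rewrite -(ler_pM2l np) -expr2 -rdotxx /rdot -hdot_proj_r.
apply: le_trans (ler_norm _) _; exact: rdot_bound.
Qed.

End projection.

Section adjoint.
Context (H1 H2 : hilbertType R k) (A : H1 -> H2).
Hypothesis bA : bounded_operator A.

Lemma bounded_operator_ge0 : exists2 M : R, 0 <= M & forall x, hnorm (A x) <= M * hnorm x.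
Proof.
have [_ [M AM]] := bA; exists `|M| => // x; apply: le_trans (AM x) _.
by rewrite ler_wpM2r ?hnorm_ge0// ler_norm.
Qed.

(** Existence of the adjoint: [x |-> <A x, y>] is a bounded functional. *)
Lemma adjointP x y : hdot (A x) y = hdot x (adjoint A y).
Proof.
move: x; rewrite /adjoint; case: xgetP => [p -> //|] no; exfalso.
have [M M0 AM] := bounded_operator_ge0; have lA := bA.1.
have [||p pP] := @riesz H1 (fun x => rdot (A x) y) (M * hnorm y).
- split=> [x z|t x]; first by rewrite (linear_add lA) (formDl (rdot_form _)).
  by rewrite (linear_scale lA) (formZl (rdot_form _)).
- move=> x; rewrite mulrAC; apply: le_trans (ler_norm _) _.
  by apply: le_trans (rdot_bound _ _) _; rewrite ler_wpM2r ?hnorm_ge0.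
apply: (no p) => x; apply/eqP; rewrite -subr_eq0; apply/eqP.
move: x; apply: homogeneous_eq0 => [c x|x].
  by rewrite (linear_scale lA) !hdotZl mulrBr.
by rewrite -mulN1r -of_realN1 sreD sre_mul_real mulN1r -!/(rdot _ _) pP rdotC subrr.
Qed.

Lemma adjoint_linear : linear (adjoint A).
Proof.
move=> c x y; apply: rdot_inj => z; rewrite ![rdot _ z]rdotC /rdot -adjointP.
by rewrite !linearDr /= !hdotZr -!adjointP.
Qed.

Lemma adjoint_bound M : 0 <= M -> (forall x, hnorm (A x) <= M * hnorm x) ->
  forall y, hnorm (adjoint A y) <= M * hnorm y.
Proof.
move=> M0 AM y; set z := adjoint A y.
have [n0|n0] := eqVneq (hnorm z) 0; first by rewrite n0 mulr_ge0 ?hnorm_ge0.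
have np : 0 < hnorm z by rewrite lt0r n0 hnorm_ge0.
rewrite -(ler_pM2l np) -expr2 -rdotxx {2}/z /rdot -adjointP.
apply: le_trans (ler_norm _) _; apply: le_trans (rdot_bound _ _) _.
by rewrite mulrCA mulrA ler_wpM2r ?hnorm_ge0.
Qed.

End adjoint.
End subspaces_and_adjoints.

(** * The frame form and the frame operator *)

Section frame.
Context (d : measure_display) (T : measurableType d) (R : realType).
Context (k : scalars) (mu : {measure set T -> \bar R}) (U : hilbertType R k).
Context (W : T -> hilbertType R k) (F : T -> closed_subspace U).
Variables (chi : forall w : T, subspace_type (F w) -> W w) (v : T -> R).
Local Arguments chi w _ : clear implicits.
Variables C D : R.
Hypothesis frame : continuous_g_fusion_frame mu chi v C D.
Implicit Types (f g h : U) (w : T).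

Let bounded_chi w : bounded_operator (chi w).
Proof. by case: frame => -[]. Qed.

Let C_gt0 : 0 < C. Proof. by case: frame. Qed.
Let D_gt0 : 0 < D. Proof. by apply: lt_le_trans C_gt0 _; case: frame. Qed.

(** The map [chi_w pi_w] from [U] to [W w]. *)
Definition analysis w f : W w := chi w (orth_proj (F w) f).

(** The map [pi_w chi_w^*] from [W w] back to [U]; it is the adjoint of
    [analysis w]. *)
Definition synthesis w (y : W w) : U :=
  subspace_val (orth_proj (F w) (adjoint (chi w) y)).

Lemma analysis_linear w : linear (analysis w).
Proof.
move=> c f g; rewrite /analysis orth_proj_linear.
by rewrite (linear_add (bounded_chi w).1) (linear_scale (bounded_chi w).1).
Qed.

Lemma hdot_synthesis w (y : W w) g : hdot (synthesis y) g = hdot y (analysis w g).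
Proof.
rewrite /synthesis orth_projK hdot_proj_r hdotC -(adjointP (bounded_chi w)).
by rewrite [RHS]hdotC.
Qed.

(** The integrand of the frame inequalities. *)
Definition energy f w : R := v w ^+ 2 * hnorm (analysis w f) ^+ 2.
(** The polar form of [energy], real part of the integrand that defines the
    frame operator. *)
Definition cross f g w : R := v w ^+ 2 * rdot (analysis w f) (analysis w g).

Lemma cross_diag f : cross f f = energy f.
Proof. by apply/funext => w; rewrite /cross rdotxx. Qed.

Lemma crossC f g w : cross f g w = cross g f w.
Proof. by rewrite /cross rdotC. Qed.

Lemma crossDl f g h w : cross (f + g) h w = cross f h w + cross g h w.
Proof.
by rewrite /cross (linear_add (@analysis_linear w)) (formDl (rdot_form _)) mulrDr.
Qed.

Lemma crossZl t f h w : cross (of_real k t *: f) h w = t * cross f h w.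
Proof.
by rewrite /cross (linear_scale (@analysis_linear w)) (formZl (rdot_form _)) mulrCA.
Qed.

Lemma cross_form w : symmetric_form (fun f g => cross f g w).
Proof.
split=> [f g|h]; first exact: crossC.
by split=> [f g|t f]; [exact: crossDl | exact: crossZl].
Qed.

Lemma cross_polar f g w :
  cross f g w = 4^-1 * (energy (f + g) w - energy (f - g) w).
Proof. by rewrite -!cross_diag !(formE (cross_form w)) (crossC g f); field. Qed.

Lemma energy_ge0 f w : 0 <= energy f w.
Proof. by rewrite mulr_ge0 ?sqr_ge0. Qed.

Lemma energy_measurable f : measurable_fun [set: T] (energy f).
Proof. by case: frame => _ _ _ /(_ f)[]. Qed.

Lemma energy_lower f : ((C * hnorm f ^+ 2)%:E <= \int[mu]_w (energy f w)%:E)%E.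
Proof. by case: frame => _ _ _ /(_ f)[]. Qed.

Lemma energy_upper f : (\int[mu]_w (energy f w)%:E <= (D * hnorm f ^+ 2)%:E)%E.
Proof. by case: frame => _ _ _ /(_ f)[]. Qed.

Lemma energy_integrable f : mu.-integrable [set: T] (EFin \o energy f).
Proof.
apply/integrableP; split.
  exact/measurable_realfun.measurable_EFinP/energy_measurable.
apply: le_lt_trans (ltry (D * hnorm f ^+ 2)).
under eq_integral do rewrite /= ger0_norm ?energy_ge0//.
exact: energy_upper.
Qed.

Lemma cross_integrable f g : mu.-integrable [set: T] (EFin \o cross f g).
Proof.
rewrite (_ : _ \o _ = fun w => (4^-1%:E * ((energy (f + g) w)%:E - (energy (f - g) w)%:E))%E).
  apply: integrableZl => //; apply: integrableB => //; exact: energy_integrable.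
by apply/funext => w /=; rewrite cross_polar EFinM EFinB.
Qed.

(** The real part of the sesquilinear form of the frame operator. *)
Definition frame_form f g : R := (\int[mu]_w cross f g w)%R.

Lemma frame_form_symmetric : symmetric_form frame_form.
Proof.
split=> [f g|h]; first by apply: eq_Rintegral => w _; exact: crossC.
split=> [f g|t f]; rewrite /frame_form.
  rewrite -RintegralD//; try exact: cross_integrable.
  by apply: eq_Rintegral => w _; exact: crossDl.
rewrite -RintegralZl//; last exact: cross_integrable.
by apply: eq_Rintegral => w _; exact: crossZl.
Qed.

Lemma frame_form_energy f :
  (frame_form f f)%:E = (\int[mu]_w (energy f w)%:E)%E.
Proof.
rewrite /frame_form cross_diag fineK//.
exact: integrable_fin_num (energy_integrable f).
Qed.

Lemma frame_form_lower f : C * hnorm f ^+ 2 <= frame_form f f.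
Proof. by rewrite -lee_fin frame_form_energy energy_lower. Qed.

Lemma frame_form_upper f : frame_form f f <= D * hnorm f ^+ 2.
Proof. by rewrite -lee_fin frame_form_energy energy_upper. Qed.

Lemma frame_form_ge0 f : 0 <= frame_form f f.
Proof.
by apply: le_trans (frame_form_lower f); rewrite mulr_ge0 ?sqr_ge0 ?ltW.
Qed.

Lemma frame_form_bound f g : `|frame_form f g| <= D * hnorm f * hnorm g.
Proof.
apply: form_bound; [exact: frame_form_symmetric|exact: ltW|..].
- exact: frame_form_ge0.
- exact: frame_form_upper.
Qed.

(** The scalar integrand that defines the frame operator; it equals
    [v^2 <chi_w pi_w f, chi_w pi_w g>]. *)
Definition integrand f g w : scalar_field R k :=
  of_real k (v w ^+ 2) * hdot (synthesis (analysis w f)) g.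

Lemma sre_integrand f g w : sre (integrand f g w) = cross f g w.
Proof. by rewrite sre_mul_real hdot_synthesis. Qed.

Lemma sim_integrand f g w :
  sim (integrand f g w) = cross f (sconj (minus_i R k) *: g) w.
Proof.
rewrite sim_mul_real hdot_synthesis sim_sre /cross /rdot.
by rewrite (linear_scale (@analysis_linear w)) hdotZr sconjK.
Qed.

(** Representing the real form [frame_form f] suffices, since imaginary parts
    are real parts at [conj(- i) g]. *)
Lemma has_integral_of_rdot f (y : U) :
  (forall g, rdot y g = frame_form f g) ->
  forall g, has_scalar_integral mu (integrand f g) (hdot y g).
Proof.
move=> yP g; split.
- rewrite (_ : (fun w => _) = EFin \o cross f g); first exact: cross_integrable.
  by apply/funext => w /=; rewrite sre_integrand.
- rewrite (_ : (fun w => _) = EFin \o cross f (sconj (minus_i R k) *: g)).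
    exact: cross_integrable.
  by apply/funext => w /=; rewrite sim_integrand.
- rewrite -/(rdot y g) yP.
  by apply: eq_Rintegral => w _; rewrite sre_integrand.
- have -> : sim (hdot y g) = rdot y (sconj (minus_i R k) *: g).
    by rewrite sim_sre /rdot hdotZr sconjK.
  rewrite yP; by apply: eq_Rintegral => w _; rewrite sim_integrand.
Qed.

Local Notation S := (frame_operator mu chi v).

(** The integral that defines [S f] exists weakly: the vector representing
    [frame_form f] is a witness. *)
Lemma frame_operatorP f g : has_scalar_integral mu (integrand f g) (hdot (S f) g).
Proof.
rewrite /frame_operator; case: xgetP => [y -> /(_ g)//|] no; exfalso.
have [||y yP] := @riesz _ _ U (frame_form f) (D * hnorm f).
- split=> [x z|t x]; first by rewrite (formDr frame_form_symmetric).
  by rewrite (formZr frame_form_symmetric).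
- by move=> x; apply: le_trans (ler_norm _) (frame_form_bound _ _).
by apply: (no y) => h; apply: has_integral_of_rdot => g'; rewrite yP.
Qed.

Lemma rdot_frame_operator f g : rdot (S f) g = frame_form f g.
Proof.
rewrite /rdot; have [_ _ -> _] := frame_operatorP f g.
by apply: eq_Rintegral => w _; rewrite sre_integrand.
Qed.

(** This turns linearity over the reals of the frame operator into linearity
    over its scalars. *)
Lemma cross_adjoint c f g w : cross (c *: f) g w = cross f (sconj c *: g) w.
Proof.
rewrite /cross !(linear_scale (@analysis_linear w)) /rdot hdotZl hdotZr.
by rewrite sconjK.
Qed.

Lemma frame_operator_linear : linear S.
Proof.
move=> c f g; apply: rdot_inj => h.
rewrite rdot_frame_operator (formDl frame_form_symmetric).
rewrite (formDl (rdot_form U)); congr (_ + _); last first.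
  exact/esym/rdot_frame_operator.
transitivity (frame_form f (sconj c *: h)).
  by apply: eq_Rintegral => w _; exact: cross_adjoint.
by rewrite -rdot_frame_operator /rdot hdotZr hdotZl sconjK.
Qed.

Lemma frame_operator_lower f : C * hnorm f <= hnorm (S f).
Proof.
have [n0|n0] := eqVneq (hnorm f) 0; first by rewrite n0 mulr0 hnorm_ge0.
have np : 0 < hnorm f by rewrite lt0r n0 hnorm_ge0.
rewrite -(ler_pM2r np) -mulrA -expr2; apply: le_trans (frame_form_lower f) _.
rewrite -rdot_frame_operator.
apply: le_trans (ler_norm _) _; exact: rdot_bound.
Qed.

Lemma frame_operator_upper f : hnorm (S f) <= D * hnorm f.
Proof.
have [n0|n0] := eqVneq (hnorm (S f)) 0.
  by rewrite n0 mulr_ge0 ?hnorm_ge0 ?ltW.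
have np : 0 < hnorm (S f) by rewrite lt0r n0 hnorm_ge0.
rewrite -(ler_pM2r np) -expr2 -rdotxx rdot_frame_operator.
by apply: le_trans (ler_norm _) (frame_form_bound _ _).
Qed.

Lemma frame_operator_inj : injective S.
Proof.
move=> f g fg; apply/eqP; rewrite -subr_eq0; apply/eqP/hnorm_eq0/eqP.
rewrite eq_le hnorm_ge0 andbT -(pmulr_rle0 _ C_gt0).
apply: le_trans (frame_operator_lower _) _.
rewrite addrC -scaleN1r frame_operator_linear fg scaleN1r addNr.
by rewrite hnorm0.
Qed.

Lemma frame_operator_surj h : exists f, S f = h.
Proof.
have [f fP] := @riesz_form _ _ U frame_form (rdot h) C D (hnorm h)
  frame_form_symmetric
  (conj (fun x y => formDr (rdot_form U) x y h)
        (fun t x => formZr (rdot_form U) t x h))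
  C_gt0 (ltW D_gt0) frame_form_lower frame_form_upper
  (fun x => le_trans (ler_norm _) (rdot_bound _ _)).
by exists f; apply: rdot_inj => g; rewrite rdot_frame_operator fP.
Qed.

Local Notation Sinv := (pinv [set: U] S).

Lemma frame_operatorK h : S (Sinv h) = h.
Proof.
apply: (@surjpK _ _ _ [set: U] [set: U]); last by rewrite inE.
by move=> g _; have [f <-] := frame_operator_surj g; exists f.
Qed.

Lemma frame_inverse_linear : linear Sinv.
Proof.
move=> c f g; apply: frame_operator_inj.
by rewrite frame_operator_linear !frame_operatorK.
Qed.

Lemma frame_inverse_upper h : hnorm (Sinv h) <= hnorm h / C.
Proof.
rewrite ler_pdivlMr// mulrC -{2}(frame_operatorK h).
exact: frame_operator_lower.
Qed.

Lemma frame_inverse_lower h : hnorm h / D <= hnorm (Sinv h).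
Proof.
rewrite ler_pdivrMr// mulrC -{1}(frame_operatorK h).
exact: frame_operator_upper.
Qed.

Lemma bounded_resolution w :
  bounded_operator (fun f => of_real k (v w ^+ 2) *: synthesis (analysis w (Sinv f))).
Proof.
split=> [c f g|].
  rewrite frame_inverse_linear analysis_linear /synthesis.
  rewrite (adjoint_linear (bounded_chi w)) !orth_projK.
  by rewrite scalerDr !scalerA mulrC.
have [M M0 chiM] := bounded_operator_ge0 (bounded_chi w).
exists (v w ^+ 2 * (M * (M * C^-1))) => f.
rewrite -(mulrA (v w ^+ 2)) -!(mulrA M).
rewrite hnorm_real_scale ?sqr_ge0//; apply: ler_wpM2l; first exact: sqr_ge0.
rewrite /synthesis orth_projK.
apply: le_trans (adjoint_bound (bounded_chi w) M0 chiM _) _.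
apply: ler_wpM2l => //; apply: le_trans (chiM _) _; apply: ler_wpM2l => //.
apply: le_trans (orth_proj_bound _ _) _.
by rewrite mulrC frame_inverse_upper.
Qed.

End frame.

(** * Resolution of the identity *)

Theorem theorem5 (d : measure_display) (T : measurableType d) (R : realType)
  (k : scalars) (mu : {measure set T -> \bar R}) (U : hilbertType R k)
  (W : T -> hilbertType R k) (F : T -> closed_subspace U)
  (chi : forall w : T, subspace_type (F w) -> W w) (v : T -> R) (C D : R) :
  separable_space U ->
  continuous_g_fusion_frame mu chi v C D ->
  let Sinv : U -> U := pinv [set: U] (frame_operator mu chi v) in
  let Tw (w : T) (f : U) : W w := chi w (orth_proj (F w) (Sinv f)) in
  resolution_of_identity mu
    (fun w f => of_real k (v w ^+ 2) *:
       subspace_val (orth_proj (F w) (adjoint (chi w) (Tw w f)))) /\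
  forall f : U,
    let q (w : T) : R := v w ^+ 2 * hnorm (Tw w f) ^+ 2 in
    [/\ measurable_fun [set: T] q,
        ((C / D ^+ 2 * hnorm f ^+ 2)%:E <= \int[mu]_w (q w)%:E)%E &
        (\int[mu]_w (q w)%:E <= (D / C ^+ 2 * hnorm f ^+ 2)%:E)%E].
Proof.
move=> _ frame Sinv Tw.
have [_ C0 CD _] := frame; have D0 := lt_le_trans C0 CD.
split.
  split=> [w|f g]; first exact: (bounded_resolution frame w).
  have := frame_operatorP frame (Sinv f) g.
  rewrite (frame_operatorK frame); congr (has_scalar_integral _ _ _).
  by apply/funext => w; rewrite hdotZl.
move=> f q; split.
- exact: (energy_measurable frame (Sinv f)).
- apply: le_trans (energy_lower frame (Sinv f)); rewrite lee_fin.
  rewrite -mulrA ler_pM2l// mulrC -expr_div_n.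
  rewrite ler_sqr ?nnegrE ?divr_ge0 ?hnorm_ge0 ?(ltW D0)//.
  exact: (frame_inverse_lower frame).
- apply: (le_trans (energy_upper frame (Sinv f))); rewrite lee_fin.
  rewrite -mulrA ler_pM2l// [leRHS]mulrC -expr_div_n.
  rewrite ler_sqr ?nnegrE ?divr_ge0 ?hnorm_ge0 ?(ltW C0)//.
  exact: (frame_inverse_upper frame).
Qed.
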